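(* $(\mathbb{F}_2,\leq_2)$ is distributive: if $f$ is a function and $(g_i)_{i\in I}$ a set-indexed family of functions with $f\leq_2\lceil g_i\rceil_{i\in I}$, then there is a family of functions $(f_i)_{i\in I}$ with $f_i\leq_2 g_i$ for all $i\in I$ and $f\equiv_2\lceil f_i\rceil_{i\in I}$.
   Context: All functions are between topological spaces. A partial function $F:\subseteq X\to Y$ is continuous if continuous on $\operatorname{dom}(F)$ with the subspace topology. For functions $f:\underline{X}_1\to\underline{Y}_1$, $g:\underline{X}_2\to\underline{Y}_2$, $f\leq_2 g$ means there are continuous partial functions $F:\subseteq\underline{X}_1\times\underline{Y}_2\to\underline{Y}_1$ and $G:\subseteq\underline{X}_1\to\underline{X}_2$ with $f(x)=F(x,g(G(x)))$ (all defined) for all $x\in X_1$; $\equiv_2$ is the induced equivalence and $\mathbb{F}_2$ the class of equivalence classes. The coproduct $\coprod_{i\in I}\underline{X}_i$ is $\bigcup_i\{i\}\times X_i$ with the smallest topology containing all $\{i\}\times U$, $U$ open in $\underline{X}_i$; for $g_i:\underline{X}_i\to\underline{Y}_i$, $\lceil g_i\rceil_{i\in I}(i,x)=(i,g_i(x))$ defines $\lceil g_i\rceil_{i\in I}:\coprod_i\underline{X}_i\to\coprod_i\underline{Y}_i$. It is known that $\lceil g_i\rceil_{i\in I}$ is the supremum of the $g_i$ in $(\mathbb{F}_2,\leq_2)$. A complete join-semilattice is called distributive iff $x\leq\sup_{i\in I}y_i$ implies the existence of $(x_i)_{i\in I}$ with $x_i\leq y_i$ for all $i$ and $x=\sup_{i\in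 I}x_i$. *)

(* Defs.v *)
From HB Require Import structures.
From mathcomp Require Import all_boot all_order all_algebra.
From mathcomp Require Import all_classical topology.

Set Implicit Arguments.
Unset Strict Implicit.
Unset Printing Implicit Defensive.

Local Open Scope classical_set_scope.

(* The domain is a subtype carrying the subspace topology (set_type with the
   initial topology of set_val), so that partial functions into an empty space
   also exist; a total function on X together with a domain would miss them. *)
Record pcontinuous_fun (X Y : topologicalType) := PContinuousFun {
  pdom : set X;
  pval : pdom -> Y;
  pval_continuous : continuous pval
}.

Definition pmaps (X Y : topologicalType) (F : pcontinuous_fun X Y)
    (x : X) (y : Y) : Prop :=
  exists u : pdom F, set_val u = x /\ pval u = y.

(* The two pmaps conditions together say that x is in dom G, that
   (x, g (G x)) is in dom F, and that F (x, g (G x)) = f x. *)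
Definition le2 (X1 Y1 X2 Y2 : topologicalType)
    (f : X1 -> Y1) (g : X2 -> Y2) : Prop :=
  exists (F : pcontinuous_fun (X1 * Y2)%type Y1) (G : pcontinuous_fun X1 X2),
    forall x : X1, exists x2 : X2,
      pmaps G x x2 /\ pmaps F (x, g x2) (f x).

Definition equiv2 (X1 Y1 X2 Y2 : topologicalType)
    (f : X1 -> Y1) (g : X2 -> Y2) : Prop :=
  le2 f g /\ le2 g f.

(* Coproduct spaces are {i : I & X i} with the library's topology, whose open
   sets are the U with every preimage under existT X i open (sigT_openP),
   i.e. the unions of sets {i} x V with V open in X i. *)
Definition coprod_fun (I : choiceType) (X Y : I -> topologicalType)
    (g : forall i, X i -> Y i) (u : {i : I & X i}) : {i : I & Y i} :=
  existT (fun i => Y i) (projT1 u) (g (projT1 u) (projT2 u)).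

(* Main.v *)
Require Import Defs.
From HB Require Import structures.
From mathcomp Require Import all_boot all_order all_algebra.
From mathcomp Require Import all_classical topology.

(** A reduction of [f] to the coproduct of the [g i] has a total continuous
    inner map [G : X -> {i & A i}]. Coproducts of spaces are stable under
    pullback: [X] is the coproduct of the pullbacks of the summands [A i]
    along [G]. Restricting [f] to these pullbacks gives the required family:
    the [i]-th restriction reduces to [g i] because on the [i]-th pullback [G]
    takes its values in the [i]-th summand. *)

Set Implicit Arguments.
Unset Strict Implicit.
Unset Printing Implicit Defensive.

Local Open Scope classical_set_scope.

Section continuity.
Implicit Types X Y Z : topologicalType.

Lemma comp_continuous X Y Z (h : X -> Y) (k : Y -> Z) :
  continuous h -> continuous k -> continuous (k \o h).
Proof. by move=> ch ck x; apply: continuous_comp; [exact: ch|exact: ck]. Qed.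

Lemma pair_continuous X Y Z (h : Z -> X) (k : Z -> Y) :
  continuous h -> continuous k -> continuous (fun z => (h z, k z)).
Proof. by move=> ch ck z; apply: cvg_pair; [exact: ch|exact: ck]. Qed.

Lemma fst_continuous X Y : continuous (@fst X Y).
Proof. by move=> z; exact: cvg_fst. Qed.

Lemma snd_continuous X Y : continuous (@snd X Y).
Proof. by move=> z; exact: cvg_snd. Qed.

Lemma projT2_continuous (I : choiceType) Y :
  continuous (fun u : {_ : I & Y} => projT2 u).
Proof. by move=> [i y]. Qed.

Lemma existT_tag_continuous (I : choiceType) (X : I -> topologicalType) Y :
  continuous
    (fun w : {i & X i} * Y => existT (fun=> Y : Type) (projT1 w.1) w.2).
Proof.
move=> [[i x] y] U /= nU.
exists (existT X i @` setT, existT (fun=> Y : Type) i @^-1` U).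
  by split=> //=; apply: existT_nbhs; exact: filterT.
by move=> [_ y'] [/= [x' _ <-]].
Qed.

Lemma set_val_continuous X (D : set X) : continuous (set_val : D -> X).
Proof. exact: (@initial_continuous D X set_val). Qed.

Lemma continuous_into_subtype X Z (D : set X) (h : Z -> D) :
  continuous (set_val \o h) -> continuous h.
Proof. exact: (@continuous_comp_initial D Z X set_val h). Qed.

Definition preimage_restrict X Z (h : Z -> X) (D : set X) (u : h @^-1` D) : D :=
  SigSub (mem_set (set_valP u : D (h (set_val u)))).

Lemma preimage_restrict_continuous X Z (h : Z -> X) (D : set X) :
  continuous h -> continuous (@preimage_restrict X Z h D).
Proof.
move=> ch; apply: continuous_into_subtype.
by apply: comp_continuous ch; exact: set_val_continuous.
Qed.

End continuity.

Section pmaps.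
Implicit Types X Y Z : topologicalType.

Lemma pmaps_functional X Y (F : pcontinuous_fun X Y) x y y' :
  pmaps F x y -> pmaps F x y' -> y = y'.
Proof. by move=> [u [<- <-]] [v [/val_inj -> <-]]. Qed.

Lemma pmaps_dom X Y (F : pcontinuous_fun X Y) x y : pmaps F x y -> pdom F x.
Proof. by move=> [u [<- _]]; exact: set_valP. Qed.

Lemma pmaps_pval X Y (F : pcontinuous_fun X Y) (u : pdom F) y :
  pmaps F (set_val u) y -> pval u = y.
Proof. by apply: pmaps_functional; exists u. Qed.

Definition total_pcontinuous X Y (h : X -> Y) (ch : continuous h) :
    pcontinuous_fun X Y :=
  PContinuousFun (comp_continuous (@set_val_continuous X setT) ch).

Lemma pmaps_total X Y (h : X -> Y) (ch : continuous h) x :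
  pmaps (total_pcontinuous ch) x (h x).
Proof. by exists (to_setT x). Qed.

Section precomp.
Variables (X Y Z : topologicalType) (F : pcontinuous_fun X Y).
Variables (h : Z -> X) (ch : continuous h).

Definition precomp_pcontinuous : pcontinuous_fun Z Y := PContinuousFun
  (comp_continuous (preimage_restrict_continuous ch) (@pval_continuous _ _ F)).

Lemma pmaps_precomp z y : pmaps F (h z) y -> pmaps precomp_pcontinuous z y.
Proof.
move=> Fhz; exists (SigSub (mem_set (pmaps_dom Fhz : (h @^-1` pdom F) z))).
by split=> //=; exact: pmaps_pval.
Qed.

End precomp.
End pmaps.

Section le2.
Variables (X1 Y1 X2 Y2 : topologicalType) (f : X1 -> Y1) (g : X2 -> Y2).

Lemma le2P :
  le2 f g <-> exists (F : pcontinuous_fun (X1 * Y2)%type Y1) (G : X1 -> X2),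
    continuous G /\ forall x, pmaps F (x, g (G x)) (f x).
Proof.
split=> [[F [G FG]]|[F [G [cG FG]]]]; last first.
  exists F, (total_pcontinuous cG) => x; exists (G x).
  by split; [exact: pmaps_total|exact: FG].
have domG x : pdom G x by have [? [/pmaps_dom]] := FG x.
pose u x : pdom G := SigSub (mem_set (domG x)).
exists F, (@pval _ _ G \o u); split=> [|x].
  apply: comp_continuous (@pval_continuous _ _ G).
  by apply: continuous_into_subtype => x; exact: cvg_id.
by have [x2 [Gx Fx]] := FG x; rewrite /= (pmaps_pval (u := u x) Gx).
Qed.

Lemma le2_total (F : X1 * Y2 -> Y1) (G : X1 -> X2) :
  continuous F -> continuous G -> (forall x, F (x, g (G x)) = f x) -> le2 f g.
Proof.
move=> cF cG FG; apply/le2P; exists (total_pcontinuous cF), G; split=> // x.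
by rewrite -FG; exact: pmaps_total.
Qed.

End le2.

Section pullback.
Variables (X A : topologicalType) (Z : Type) (G : X -> Z) (k : A -> Z).

Definition pullback : set (X * A)%type := [set z | G z.1 = k z.2].

Definition pullback_fst : pullback -> X := fst \o set_val.

Definition pullback_snd : pullback -> A := snd \o set_val.

Lemma pullback_fst_continuous : continuous pullback_fst.
Proof.
exact: comp_continuous (@set_val_continuous _ _) (@fst_continuous _ _).
Qed.

Lemma pullback_snd_continuous : continuous pullback_snd.
Proof.
exact: comp_continuous (@set_val_continuous _ _) (@snd_continuous _ _).
Qed.

Lemma pullback_comm (z : pullback) : G (pullback_fst z) = k (pullback_snd z).
Proof. exact: set_valP z. Qed.

End pullback.

Arguments pullback_fst {X A Z} G k.
Arguments pullback_snd {X A Z} G k.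

Lemma le2_comp_pullback_fst (X Y A B A' B' : topologicalType)
    (f : X -> Y) (g : A -> B) (g' : A' -> B') (k : A' -> A) (j : B' -> B)
    (F : pcontinuous_fun (X * B)%type Y) (G : X -> A) :
  continuous j -> g \o k =1 j \o g' ->
  (forall x, pmaps F (x, g (G x)) (f x)) -> le2 (f \o pullback_fst G k) g'.
Proof.
move=> cj gkj FG.
pose h (w : pullback G k * B') := (pullback_fst G k w.1, j w.2).
have ch : continuous h.
  apply: pair_continuous; apply: comp_continuous.
  - exact: fst_continuous.
  - exact: pullback_fst_continuous.
  - exact: snd_continuous.
  - exact: cj.
apply/le2P; exists (precomp_pcontinuous F ch), (pullback_snd G k).
split=> [|z]; first exact: pullback_snd_continuous.
apply: pmaps_precomp; rewrite /h /= -[j _]gkj /= -pullback_comm; exact: FG.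
Qed.

Section coprod_pullback.
Variables (I : choiceType) (A : I -> topologicalType) (X : topologicalType).
Variable G : X -> {i : I & A i}.

Definition summand_pullback (i : I) : topologicalType :=
  pullback G (existT A i).

Lemma mem_summand_pullback x :
  (x, projT2 (G x)) \in pullback G (existT A (projT1 (G x))).
Proof. by apply/mem_set; exact/esym/surjective_existT. Qed.

Definition to_coprod_pullback x : {i : I & summand_pullback i} :=
  existT summand_pullback (projT1 (G x)) (SigSub (mem_summand_pullback x)).

Lemma to_coprod_pullbackE i (z : summand_pullback i) :
  to_coprod_pullback (pullback_fst G (existT A i) z) =
  existT summand_pullback i z.
Proof.
case: z => [[x a] xaP]; have Gx : G x = existT A i a by exact: set_mem xaP.
rewrite /to_coprod_pullback /=; move: (mem_summand_pullback x).
by rewrite /pullback_fst /= Gx /= => xaP'; congr existT; exact: val_inj.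
Qed.

(* The image of the [i]-th summand is open, so near [x] the map [G] stays in
   the summand of [G x], where [to_coprod_pullback] is [y |-> (y, G y)]. *)
Lemma to_coprod_pullback_continuous :
  continuous G -> continuous to_coprod_pullback.
Proof.
move=> cG x U [_ /= [[W oW <-] Wx WU]].
have [[P Q] [nP nQ] PQW] : nbhs (x, projT2 (G x)) W by exact: open_nbhs_nbhs.
have nGQ : nbhs (G x) (existT A (projT1 (G x)) @` Q).
  by have := existT_nbhs _ _ _ nQ; rewrite surjective_existT.
apply: filterS (filterI nP (cG x _ nGQ)) => y [Py [a Qa /esym Gy]].
pose z : summand_pullback (projT1 (G x)) :=
  SigSub (mem_set (Gy : pullback G _ (y, a))).
rewrite /preimage /= -[y]/(pullback_fst G _ z) to_coprod_pullbackE.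
by apply: WU; exact: (PQW (y, a)).
Qed.

End coprod_pullback.

Lemma le2_coprod_fun_comp (I : choiceType) (X Y : topologicalType) (f : X -> Y)
    (Z : I -> topologicalType) (h : forall i, Z i -> X) :
  (forall i, continuous (h i)) -> le2 (coprod_fun (fun i => f \o h i)) f.
Proof.
move=> ch.
apply: (le2_total (G := fun u => h (projT1 u) (projT2 u))
  (@existT_tag_continuous I Z Y)) => //.
exact: sigT_continuous.
Qed.

Lemma le2_coprod_fun_section (I : choiceType) (X Y : topologicalType)
    (f : X -> Y) (Z : I -> topologicalType) (h : forall i, Z i -> X)
    (s : X -> {i & Z i}) :
  continuous s -> (forall x, h (projT1 (s x)) (projT2 (s x)) = x) ->
  le2 f (coprod_fun (fun i => f \o h i)).
Proof.
move=> cs hs.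
apply: (le2_total (F := fun w : X * {_ : I & Y} => projT2 w.2) _ cs).
  exact: comp_continuous (@snd_continuous _ _) (@projT2_continuous _ _).
by move=> x /=; rewrite hs.
Qed.

Theorem theorem4p21 (X Y : topologicalType) (f : X -> Y)
    (I : choiceType) (A B : I -> topologicalType)
    (g : forall i : I, A i -> B i) :
  le2 f (coprod_fun g) ->
  exists (X' Y' : I -> topologicalType) (f' : forall i : I, X' i -> Y' i),
    (forall i : I, le2 (f' i) (g i)) /\ equiv2 f (coprod_fun f').
Proof.
move=> /le2P [F [G [cG FG]]].
exists (summand_pullback G), (fun=> Y).
exists (fun i => f \o pullback_fst G (existT A i)).
split=> [i|].
  by apply: (le2_comp_pullback_fst (j := existT B i)) FG;
    first exact: existT_continuous.
split; first exact: le2_coprod_fun_section (to_coprod_pullback_continuous cG) _.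
by apply: le2_coprod_fun_comp => i; exact: pullback_fst_continuous.
Qed.
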